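(* Let $K$ be any field of characteristic $\ell>0$, let $r\geq 1$ be an integer, and let $A=K[T_1,\dots,T_r]$ be the polynomial ring in $r$ variables over $K$. Let $f(X)$ be a polynomial with all of its coefficients in $K$. Let $q\neq \ell$ be a prime number and assume that the following conditions are satisfied. (1) $f(X)$ factorizes as $f(X)=a_0(X-a_1)^{n_1}\cdots (X-a_t)^{n_t}$, where $a_0\in K$ is nonzero, $a_1,\dots,a_t$ are distinct elements of $K$, $n_1,\dots,n_t$ are positive integers and $t\geq 2$. (2) At least two of the exponents $n_i$ are not divisible by $q$. Then any solution $(X,Y)\in A^2$ to $Y^{q}=f(X)$ is constant, i.e., $X$ and $Y$ are both in $K$. *)

(* Defs.v *)
From mathcomp Require Export all_boot all_order all_algebra.
From mathcomp Require Export mpoly.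

(* Main.v *)
(* The Kronecker substitution [T_i := T^(N^i)] with [N] large keeps nonconstant
   polynomials nonconstant, so one may take [r = 1]. In [K[T]] the factors
   [X - a_i] are pairwise coprime, so whenever [q] does not divide [n_i],
   [X - a_i] is a scalar times a [q]-th power. Subtracting two such
   factors gives [u U^q - v V^q = c] with [c] a nonzero constant, which forces
   [U] to be constant by a derivative argument that needs no roots of unity. *)

Require Import Defs.
From mathcomp Require Import all_boot all_order all_algebra.
From mathcomp Require Import mpoly.

Set Implicit Arguments.
Unset Strict Implicit.
Unset Printing Implicit Defensive.

Import GRing.Theory.
Local Open Scope ring_scope.

(** The witness is [gcdp A Y]. Writing it as [s * A + t * Y] up to a unit, its [q]-th power is
    [(t * Y) ^+ q] modulo [A], and [A] divides [Y ^+ q]. Conversely this power divides [A * B] and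
    is coprime to [B]. *)
Lemma eqp_exp_coprime_factor (K : fieldType) (q : nat) (A B Y : {poly K}) :
  (0 < q)%N -> coprimep A B -> A * B = Y ^+ q -> exists U, A %= U ^+ q.
Proof.
move=> q_gt0 coAB defY; exists (gcdp A Y); apply/andP; split.
  have [[s t] /= st] := Bezoutp A Y.
  rewrite -(eqp_dvdr _ (eqp_exp q st)) -[_ ^+ q](subrK ((t * Y) ^+ q)).
  apply: dvdp_add; last by rewrite exprMn -defY dvdp_mull // dvdp_mulr.
  by rewrite subrXX addrK dvdp_mulr // dvdp_mull.
rewrite -(@Gauss_dvdpl _ _ B) ?defY ?dvdp_exp2r ?dvdp_gcdr //.
exact/coprimep_expl/(coprimep_dvdr (dvdp_gcdl A Y)).
Qed.

(** With [a * n = b * q + 1], raising the hypothesis to the power [a] makes [A * (A ^+ b) ^+ q]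
    associate to [(U ^+ a) ^+ q]; then [W] is the quotient of [U ^+ a] by [A ^+ b]. *)
Lemma eqp_exp_root (K : fieldType) (n q : nat) (A U : {poly K}) :
  A != 0 -> (0 < n)%N -> (0 < q)%N -> coprime n q -> A ^+ n %= U ^+ q ->
  exists W, A %= W ^+ q.
Proof.
move=> A0 n_gt0 q_gt0 /eqP co_nq AU.
have [a b def_a _] := egcdnP q n_gt0.
have eqAW : A * (A ^+ b) ^+ q %= (U ^+ a) ^+ q.
  rewrite -exprM -exprS -addn1 -co_nq -def_a exprM exprAC [U ^+ a ^+ q]exprAC.
  exact: eqp_exp.
have /dvdpP[W defW] : A ^+ b %| U ^+ a.
  by rewrite -(dvdp_pexp2r _ _ q_gt0) -(eqp_dvdr _ eqAW) dvdp_mull.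
exists W; move: eqAW; rewrite defW exprMn eqp_mul2r //.
by rewrite !expf_neq0.
Qed.

(** The coefficients are kept as they are: [K] may be imperfect, so [U] need not be an [l]-th
    power. *)
Lemma deriv_eq0_comp_Xn (K : fieldType) (l : nat) (U : {poly K}) :
  l \in [pchar K] -> U^`() = 0 -> exists V, U = V \Po 'X^l.
Proof.
move=> charKl dU0; have l_gt0 := prime_gt0 (pcharf_prime charKl).
exists (\poly_(i < size U) U`_(i * l)); apply/polyP=> i.
rewrite coef_comp_poly_Xn // coef_poly; case: ifPn => [/dvdnP[k ->]|l_i].
  rewrite mulnK //; case: ltnP => // Uk.
  by rewrite nth_default // (leq_trans Uk) // leq_pmulr.
case: i l_i => [|i] l_i; first by rewrite dvdn0 in l_i.
have /eqP := congr1 (fun p : {poly K} => p`_i) dU0.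
rewrite coef_deriv coef0 -mulr_natr mulf_eq0 -(dvdn_pcharf charKl).
by rewrite (negPf l_i) orbF => /eqP.
Qed.

(* Differentiating [u U^q - v V^q = c] gives [U^(q-1) | V'], and comparing
   degrees forces [U' = V' = 0]; in characteristic [l] both [U] and [V] are then
   polynomials in ['X^l], and the equation descends to a smaller degree. *)
Lemma size_exp_sub_const (K : fieldType) (l q : nat) (u v c : K)
    (U V : {poly K}) :
  l \in [pchar K] -> (1 < q)%N -> q%:R != 0 :> K ->
  u != 0 -> v != 0 -> c != 0 ->
  u *: U ^+ q - v *: V ^+ q = c%:P -> (size U <= 1)%N.
Proof.
move=> charKl q_gt1 qK u0 v0 c0.
have q_gt0 := ltnW q_gt1; have l_gt1 := prime_gt1 (pcharf_prime charKl).
have [m] := ubnP (size U).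
elim: m => // m IHm in U V * => ltUm defc; rewrite leqNgt; apply/negP=> U1.
(* The two terms differ by a constant, so their degrees agree; [.-1] gives zero and nonzero
   constants the same value. *)
have predU : (size U).-1 = (size V).-1.
  have: (size (u *: U ^+ q)).-1 = (size (v *: V ^+ q)).-1.
    rewrite -[u *: _](subrK (v *: V ^+ q)) defc addrC.
    have [V1|V1] := leqP (size (v *: V ^+ q)) 1; last first.
      by rewrite size_polyDl // (leq_ltn_trans (size_polyC_leq1 _)).
    have: (size (v *: V ^+ q + c%:P)%R <= 1)%N.
      by rewrite (leq_trans (size_polyD _ _)) // geq_max V1 size_polyC_leq1.
    by case: (size _) V1 => [|[]] //; case: (size _) => [|[]].
  rewrite !size_scale // !size_exp => /eqP.
  by rewrite eqn_pmul2r // => /eqP.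
have sizeV : size V = size U.
  by case: (size U) (size V) predU U1 => [|[|?]] [|?] //= ->.
have nz_size (W : {poly K}) : size W = size U -> W != 0.
  by move=> sW; rewrite -size_poly_gt0 sW (ltn_trans _ U1).
have U0 := nz_size _ erefl; have V0 := nz_size _ sizeV.
have dUV : u *: (U^`() * U ^+ q.-1) = v *: (V^`() * V ^+ q.-1).
  have /eqP := congr1 (@deriv K) defc.
  rewrite derivB !derivZ !deriv_exp derivC subr_eq0 -!scaler_nat.
  by rewrite !scalerA ![_ * q%:R]mulrC -!scalerA (inj_eq (scalerI qK)) => /eqP.
(* The equation itself is a Bezout relation, since [c] is a unit. *)
have coUV : coprimep U V.
  apply/Bezout_coprimepP; exists (u *: U ^+ q.-1, - (v *: V ^+ q.-1)) => /=.
  rewrite mulNr -!scalerAl -!exprSr prednK // defc.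
  by rewrite -[c%:P]alg_polyC eqp_scale.
have dV0 : V^`() = 0.
  apply/eqP/contraT=> dV0.
  have UdV : U ^+ q.-1 %| V^`().
    rewrite -(@Gauss_dvdpl _ _ (V ^+ q.-1)) ?coprimep_expl ?coprimep_expr //.
    by rewrite -(dvdpZr _ _ v0) -dUV dvdpZr // dvdp_mull.
  have := leq_trans (dvdp_leq dV0 UdV) (ltnW (lt_size_deriv V0)).
  have := dvdp_leq dV0 (dvdp_trans (dvdp_exp _ (dvdpp U)) UdV).
  rewrite -ltnS prednK // => /(_ q_gt1); rewrite leqNgt.
  by rewrite -sizeV lt_size_deriv.
have dU0 : U^`() = 0.
  move/eqP: dUV; rewrite dV0 mul0r scaler0 scaler_eq0 (negPf u0) mulf_eq0.
  by rewrite expf_eq0 (negPf U0) andbF orbF => /eqP.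
have [U2 defU] := deriv_eq0_comp_Xn charKl dU0.
have [V2 defV] := deriv_eq0_comp_Xn charKl dV0.
have sU : (size U).-1 = ((size U2).-1 * l)%N.
  by rewrite defU size_comp_poly size_polyXn.
have U2_gt1 : (1 < size U2)%N.
  by case: (size U2) sU => [|[|]] //; case: (size U) U1 => [|[]].
have ltU2 : (size U2 < size U)%N.
  rewrite -(prednK (ltnW U1)) sU -[X in (X < _)%N](prednK (ltnW U2_gt1)) ltnS.
  by rewrite ltn_Pmulr // -ltnS prednK // ltnW.
suff: (size U2 <= 1)%N by rewrite leqNgt U2_gt1.
apply: (IHm _ V2); first exact: leq_trans ltU2 ltUm.
apply/eqP; rewrite -subr_eq0; apply/eqP.
(* Composition with ['X^l] is injective, so the equation for [U], [V] holds already for [U2],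
   [V2]. *)
have: (u *: U2 ^+ q - v *: V2 ^+ q - c%:P) \Po 'X^l = 0.
  rewrite !comp_polyB !comp_polyZ !rmorphXn /= -defU -defV comp_polyC defc.
  by rewrite subrr.
by move/eqP; rewrite comp_poly_eq0 ?size_polyXn ?ltnS ?(ltnW l_gt1) // => /eqP.
Qed.

Lemma size_superelliptic_sol (K : fieldType) (l q t : nat) (a0 : K)
    (a : 'I_t -> K) (n : 'I_t -> nat) (X Y : {poly K}) :
  l \in [pchar K] -> prime q -> q != l -> a0 != 0 -> injective a ->
  (forall i, (0 < n i)%N) ->
  (1 < #|[set i : 'I_t | ~~ (q %| n i)%N]|)%N ->
  Y ^+ q = (a0 *: \prod_(i < t) ('X - (a i)%:P) ^+ n i) \Po X ->
  (size X <= 1)%N.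
Proof.
move=> charKl q_pr q_l a0_n0 inj_a n_gt0 n_q defY.
have q_gt0 := prime_gt0 q_pr; rewrite leqNgt; apply/negP=> X1.
have XaE b : ('X - b%:P) \Po X = X - b%:P.
  by rewrite comp_polyB comp_polyX comp_polyC.
have Xa_n0 b : X - b%:P != 0.
  rewrite subr_eq0; apply: contraTneq X1 => ->.
  by rewrite -leqNgt size_polyC_leq1.
(* Coprimality of [('X - a_i) ^+ n i] with the cofactor [R] survives composition with [X]. Hence
   [(X - a_i) ^+ n i] is associate to a [q]-th power, and so is [X - a_i] because [q] is prime to
   [n i]. *)
have root_i i : ~~ (q %| n i)%N -> exists2 u, u != 0 &
    exists U, X - (a i)%:P = u *: U ^+ q.
  move=> n_i; pose R := a0 *: \prod_(j < t | j != i) ('X - (a j)%:P) ^+ n j.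
  have coR : coprimep (('X - (a i)%:P) ^+ n i) R.
    rewrite coprimep_expl // coprimep_sym coprimep_XsubC rootZ //.
    rewrite /root horner_prod prodf_seq_neq0.
    apply/allP=> j _; apply/implyP=> j_i.
    by rewrite horner_exp hornerXsubC expf_neq0 // subr_eq0 (inj_eq inj_a) eq_sym.
  have := coprimep_comp_poly X coR; rewrite rmorphXn /= XaE => coXR.
  have [|U defU] := @eqp_exp_coprime_factor _ q _ _ Y q_gt0 coXR.
    by rewrite defY /R [in RHS](bigD1 i) //= !comp_polyZ
               comp_polyM rmorphXn /= XaE scalerAr.
  have [|W] := eqp_exp_root (Xa_n0 _) (n_gt0 i) q_gt0 _ defU.
    by rewrite coprime_sym prime_coprime.
  by case/eqpf_eq=> u u0 defW; exists u => //; exists W.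
have /card_gt1P[i [j []]] := n_q; rewrite !inE => /root_i[u u0 [U defU]].
move=> /root_i[v v0 [V defV]] i_j.
(* Here [c] is [(X - a_i) - (X - a_j)], in which [X] cancels. *)
have U1 : (size U <= 1)%N.
  apply: (@size_exp_sub_const K l q u v (a j - a i) U V) => //.
  - exact: prime_gt1.
  - by rewrite -(dvdn_pcharf charKl) dvdn_prime2 1?eq_sym ?(pcharf_prime charKl).
  - by rewrite subr_eq0 (inj_eq inj_a) eq_sym.
  - by rewrite -defU -defV opprB addrC addrA subrK polyCB.
have: (size (X - (a i)%:P)%R <= 1)%N.
  rewrite defU size_scale //; have := size_exp U q.
  by case: (size U) U1 => [|[]] // _; rewrite mul0n; case: (size _) => [|[]].
rewrite leqNgt size_polyDl ?X1 // size_polyN.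
exact: leq_ltn_trans (size_polyC_leq1 _) X1.
Qed.

Lemma eq_base_expansion (N r : nat) (m m' : 'I_r -> nat) :
  (forall i, m i < N)%N -> (forall i, m' i < N)%N ->
  (\sum_(i < r) m i * N ^ i = \sum_(i < r) m' i * N ^ i)%N -> m =1 m'.
Proof.
elim: r m m' => [|r IHr] m m' ltm ltm'; first by move=> _ [].
rewrite !big_ord_recl !expn0 !muln1.
have shift (k : 'I_r.+1 -> nat) :
    (\sum_(i < r) k (lift ord0 i) * N ^ lift ord0 i =
     (\sum_(i < r) k (lift ord0 i) * N ^ i) * N)%N.
  by rewrite big_distrl; apply: eq_bigr => i _ /=; rewrite -mulnA -expnSr.
rewrite !shift => eq_mm'.
have N_gt0 : (0 < N)%N := leq_ltn_trans (leq0n _) (ltm ord0).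
have eq0 : m ord0 = m' ord0.
  have := congr1 (modn^~ N) eq_mm' => /=.
  by rewrite addnC modnMDl [in RHS]addnC modnMDl !modn_small.
move: eq_mm'; rewrite eq0 => /addnI/eqP; rewrite eqn_pmul2r // => /eqP eqr i.
have [j ->|->] := unliftP ord0 i; last exact: eq0.
by apply: (IHr (fun j => m (lift ord0 j)) (fun j => m' (lift ord0 j))).
Qed.

Local Notation kronecker N := (mmap polyC (fun i => 'X^(N ^ i))).

(** All exponents in [P] are below [N], so by uniqueness of base [N] digits distinct monomials go to
    distinct powers and nothing cancels. A nonconstant monomial of [P] would thus survive in
    positive degree. *)
Lemma kronecker_const (K : fieldType) (r N : nat) (P : {mpoly K[r]}) :
  (msize P <= N)%N -> (size (kronecker N P) <= 1)%N -> exists x, P = x%:MP_[r].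
Proof.
move=> ltPN s1; exists P@_0%MM; apply/mpolyP=> m; rewrite mcoeffC.
have [->|m0] := eqVneq m 0%MM; first by rewrite mulr1.
rewrite mulr0; apply/eqP; rewrite mcoeff_eq0; apply/negP=> Pm.
pose code (k : 'X_{1..r}) := (\sum_(i < r) k i * N ^ i)%N.
have lt_digit k i : k \in msupp P -> (k i < N)%N.
  move=> Pk; apply: leq_trans ltPN; apply: leq_ltn_trans (msize_mdeg_lt Pk).
  by rewrite mdegE (bigD1 i) //= leq_addr.
have code_inj k : k \in msupp P -> code k = code m -> k = m.
  move=> Pk /(@eq_base_expansion N r) eq_km; apply/mnmP.
  by apply: eq_km => i; apply: lt_digit.
have : (kronecker N P)`_(code m) = P@_m.
  rewrite /mmap coef_sum.
  have coefE k : ((P@_k)%:P * mmap1 (fun i : 'I_r => 'X^(N ^ i)) k)`_(code m)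
      = P@_k * (code m == code k)%:R.
    rewrite coefCM /mmap1; congr (_ * _).
    under eq_bigr do rewrite -exprM mulnC.
    by rewrite prodrXr coefXn.
  rewrite (bigD1_seq m) ?msupp_uniq //= coefE eqxx mulr1 big_seq_cond big1 ?addr0 //.
  move=> k /andP[Pk k_m]; rewrite coefE; case: eqP => [/esym/(code_inj _ Pk) kE|_].
    by rewrite kE eqxx in k_m.
  by rewrite mulr0.
(* [N] is positive because it exceeds a digit of [m], so no weight [N ^ i] vanishes. *)
have code_gt0 : (0 < code m)%N.
  rewrite lt0n; apply: contra m0; rewrite sum_nat_eq0 => /forallP m_0.
  apply/eqP/mnmP=> i; rewrite mnm0E; apply/eqP; have := m_0 i.
  by rewrite muln_eq0 expn_eq0 (gtn_eqF (leq_ltn_trans _ (lt_digit m i Pm))) ?orbF.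
rewrite nth_default ?(leq_trans s1) // => /esym/eqP.
by rewrite mcoeff_eq0 Pm.
Qed.

Theorem theorem4p1 (K : fieldType) (l : nat) (hl : l \in [pchar K])
    (r : nat) (hr : (1 <= r)%N) (f : {poly K})
    (q : nat) (hq : prime q) (hql : q <> l)
    (t : nat) (ht : (2 <= t)%N)
    (a0 : K) (ha0 : a0 <> 0)
    (a : 'I_t -> K) (ha : injective a)
    (n : 'I_t -> nat) (hn : forall i : 'I_t, (0 < n i)%N)
    (hf : f = a0 *: \prod_(i < t) ('X - (a i)%:P) ^+ n i)
    (hnq : (2 <= #|[set i : 'I_t | ~~ (q %| n i)%N]|)%N)
    (X Y : {mpoly K[r]}) (hXY : Y ^+ q = (map_poly (@mpolyC r K) f).[X]) :
  (exists x : K, X = x%:MP_[r]) /\ (exists y : K, Y = y%:MP_[r]).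
Proof.
have sol N : kronecker N Y ^+ q = f \Po kronecker N X.
  rewrite -rmorphXn hXY /= -horner_map -map_poly_comp /=.
  by congr horner; apply: eq_map_poly => x /=; rewrite mmapC.
have sizeX N : (size (kronecker N X) <= 1)%N.
  by apply: (@size_superelliptic_sol K l q t a0 a n _ (kronecker N Y));
    rewrite -?hf //; apply/eqP.
split; first exact: kronecker_const (leqnn _) (sizeX _).
apply: kronecker_const (leqnn _) _.
(* [sizeX] holds for every [N], so [N] can be fitted to [Y] this time: the image of [X] is still
   constant, hence so is that of [Y ^+ q]. *)
have : (size (kronecker (msize Y) Y ^+ q)).-1 = 0%N.
  rewrite sol; have /size1_polyC -> := sizeX (msize Y).
  by rewrite comp_polyCr size_polyC; case: eqP.
move/eqP; rewrite size_exp muln_eq0 orbC gtn_eqF ?prime_gt0 //= => /eqP.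
by case: (size _) => [|[]].
Qed.
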